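(* Let $G$ be an amenable discrete group, let $X$ be a nonempty right $G$-set, and let $E$ be a Banach left $G$-module. Let $\delta\ge 0$ be a real number and suppose that $f:X\to E^*$ and $h:G\to E^*$ are maps satisfying $$\|f(xy)-f(x)\cdot y-h(y)\|\leq\delta\qquad\text{for all }x\in X,\ y\in G.$$ Then there exist maps $F:X\to E^*$ and $H:G\to E^*$ such that for all $x\in X$ and $y,z\in G$: $$H(yz)=H(y)\cdot z+H(z),\qquad F(xy)=F(x)\cdot y+H(y),$$ $$\|H(y)-h(y)\|\leq\delta,\qquad \|F(x)-f(x)\|\leq 2\delta.$$
   Context: Banach spaces are over $\mathbb{R}$ and $E^*$ denotes the dual Banach space of $E$ with its norm. A right $G$-set is a set $X$ with a map $X\times G\to X$, $(x,y)\mapsto xy$, such that $xe=x$ and $x(yz)=(xy)z$, where $e$ is the identity of $G$. A Banach left $G$-module ($G$ a topological group, here discrete) is a Banach space $E$ with a continuous map $G\times E\to E$, $(y,\xi)\mapsto y\cdot\xi$, such that $y\cdot(y'\cdot\xi)=(yy')\cdot\xi$, $e\cdot\xi=\xi$, and each map $\xi\mapsto y\cdot\xi$ is an isometric linear automorphism of $E$. The dual $E^*$ then carries the right action of $G$ defined by $\langle\alpha\cdot y,\xi\rangle=\langle\alpha,y\cdot\xi\rangle$ for $\alpha\in E^*$, $y\in G$, $\xi\in E$. A discrete group $G$ is amenable if there is a left invariant mean on the space $\mathbf{B}(G)$ of all bounded real-valued functions on $G$ (with the sup norm), i.e. a bounded linear functional $m:\mathbf{B}(G)\to\mathbb{R}$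 with $m(1)=\|m\|=1$ and $m(x\mapsto f(yx))=m(f)$ for all $f\in\mathbf{B}(G)$, $y\in G$; equivalently, there is a right invariant mean on $\mathbf{B}(G)$ (same with $x\mapsto f(xy)$). *)

(* Defs.v *)
From HB Require Import structures.
From mathcomp Require Import all_boot all_order all_algebra.
From mathcomp Require Import all_classical all_reals all_analysis.

Set Implicit Arguments.
Unset Strict Implicit.
Unset Printing Implicit Defensive.

Import Order.TTheory GRing.Theory Num.Theory.
Import numFieldNormedType.Exports.

Local Open Scope classical_set_scope.
Local Open Scope ring_scope.

Section Dual.
Context {R : realType} (E : normedModType R).

Definition dual_pred : {pred E -> R^o} :=
  mem [set f : E -> R^o | linear f /\ continuous f].

Record dual : predArgType :=
  Dual { dual_fun :> E -> R^o; _ : dual_fun \in dual_pred }.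

HB.instance Definition _ := [isSub for dual_fun].
HB.instance Definition _ := [Choice of dual by <:].

Lemma dual_submod_closed : submod_closed dual_pred.
Proof.
split=> [|a f g]; rewrite !inE/=.
  split; last by move=> x; exact: cvg_cst.
  by move=> a x y; rewrite /= scaler0 addr0.
move=> [lf cf] [lg cg]; split.
  move=> b x y; rewrite !fctE lf lg !scalerDr !scalerA (mulrC a b).
  by rewrite addrACA.
by move=> x; apply: cvgD; [apply: cvgZl_tmp; exact: cf|exact: cg].
Qed.

HB.instance Definition _ :=
  GRing.isSubmodClosed.Build R (E -> R^o) dual_pred dual_submod_closed.
HB.instance Definition _ := [SubChoice_isSubLmodule of dual by <:].

Lemma dual_linear (f : dual) : linear f.
Proof. by have := valP f; rewrite inE => -[]. Qed.

Lemma dual_continuous (f : dual) : continuous f.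
Proof. by have := valP f; rewrite inE => -[]. Qed.

HB.instance Definition _ (f : dual) :=
  GRing.isLinear.Build R E R^o *:%R f (dual_linear f).

Definition dual_norm (f : dual) : R :=
  sup [set `|f x : R| | x in [set x : E | `|x| <= 1]].

Lemma dual_norm_has_ubound (f : dual) :
  has_ubound [set `|f x : R| | x in [set x : E | `|x| <= 1]].
Proof.
have /linear_bounded_continuous/linear_boundedP := @dual_continuous f.
move=> /pinfty_ex_gt0[r r0 fr]; exists r => _ [x /= x1 <-].
by rewrite (le_trans (fr x))// ger_pMr.
Qed.

Lemma dual_norm_ub (f : dual) x : `|x| <= 1 -> `|f x| <= dual_norm f.
Proof.
by move=> x1; apply: ub_le_sup; [exact: dual_norm_has_ubound|exists x].
Qed.

Lemma dual_norm_le (f : dual) (M : R) :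
  (forall x, `|x| <= 1 -> `|f x| <= M) -> dual_norm f <= M.
Proof.
move=> fM; apply: ge_sup; first by exists `|f 0|, 0; rewrite //= normr0.
by move=> _ [x /= x1 <-]; exact: fM.
Qed.

Lemma dual_norm_ge0 (f : dual) : 0 <= dual_norm f.
Proof. by rewrite (le_trans _ (@dual_norm_ub f 0 _)) ?normr0. Qed.

Lemma dual_norm_eval (f : dual) x : `|f x| <= dual_norm f * `|x|.
Proof.
have [->|x0] := eqVneq x 0; first by rewrite linear0 !normr0 mulr0.
have nx : 0 < `|x| by rewrite normr_gt0.
rewrite -ler_pdivrMr//.
have : `|f (`|x|^-1 *: x)| <= dual_norm f.
  by apply: dual_norm_ub; rewrite normrZ normfV normr_id mulVf// gt_eqF.
by rewrite linearZ/= normrZ normfV normr_id mulrC.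
Qed.

Lemma dual_normD (f g : dual) : dual_norm (f + g) <= dual_norm f + dual_norm g.
Proof.
apply: dual_norm_le => x x1; rewrite (le_trans (ler_normD _ _))//.
by rewrite lerD// dual_norm_ub.
Qed.

Lemma dual_normZ (a : R) (f : dual) : dual_norm (a *: f) = `|a| * dual_norm f.
Proof.
have le b (g : dual) : dual_norm (b *: g) <= `|b| * dual_norm g.
  by apply: dual_norm_le => x x1; rewrite normrM ler_wpM2l// dual_norm_ub.
apply/eqP; rewrite eq_le le/=.
have [->|a0] := eqVneq a 0; first by rewrite normr0 mul0r dual_norm_ge0.
rewrite -ler_pdivlMl ?normr_gt0// -normfV -[in leLHS](scalerK a0 f).
exact: le.
Qed.

Lemma dual_norm0_eq0 (f : dual) : dual_norm f = 0 -> f = 0.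
Proof.
move=> f0; apply/val_inj/funext => x; apply/eqP.
by rewrite -normr_le0 (le_trans (dual_norm_eval f x))// f0 mul0r.
Qed.

HB.instance Definition _ :=
  Lmodule_isNormed.Build R dual dual_normD dual_normZ dual_norm0_eq0.

End Dual.

Section BoundedFunctions.
Context (R : realType) (T : Type).

Definition bfun_pred : {pred T -> R^o} :=
  mem [set f : T -> R^o | bounded_fun f].

Record bfun : predArgType :=
  BFun { bfun_fun :> T -> R^o; _ : bfun_fun \in bfun_pred }.

HB.instance Definition _ := [isSub for bfun_fun].
HB.instance Definition _ := [Choice of bfun by <:].

Lemma bfun_predP (f : T -> R^o) :
  (exists M : R, forall x, `|f x| <= M) <-> f \in bfun_pred.
Proof.
rewrite inE/=; split=> [[M fM]|[M [_ fM]]].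
  exists M; split=> [|N MN x _]; first exact: num_real.
  exact: le_trans (fM x) (ltW MN).
by exists (M + 1) => x; apply: fM; rewrite ?ltrDl.
Qed.

Lemma bfun_submod_closed : submod_closed bfun_pred.
Proof.
split=> [|a f g]; first by apply/bfun_predP; exists 0 => x; rewrite normr0.
move=> /bfun_predP[M fM] /bfun_predP[N gN]; apply/bfun_predP.
exists (`|a| * M + N) => x; rewrite (le_trans (ler_normD _ _))// lerD//.
by rewrite normrM ler_wpM2l.
Qed.

HB.instance Definition _ :=
  GRing.isSubmodClosed.Build R (T -> R^o) bfun_pred bfun_submod_closed.
HB.instance Definition _ := [SubChoice_isSubLmodule of bfun by <:].

(* The supremum of the empty set is 0, so this is also correct for empty T. *)
Definition bfun_norm (f : bfun) : R := sup (range (fun x => `|f x : R|)).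

Lemma bfun_norm_ub (f : bfun) x : `|f x| <= bfun_norm f.
Proof.
apply: ub_le_sup; last by exists x.
by have /bfun_predP[M fM] := valP f; exists M => _ [y _ <-]; exact: fM.
Qed.

Lemma bfun_norm_le (f : bfun) (M : R) :
  0 <= M -> (forall x, `|f x| <= M) -> bfun_norm f <= M.
Proof.
move=> M0 fM; rewrite /bfun_norm.
have [->|A0] := eqVneq (range (fun x => `|f x : R|)) set0; first by rewrite sup0.
by apply: ge_sup; [exact/set0P|move=> _ [x _ <-]].
Qed.

Lemma bfun_norm_ge0 (f : bfun) : 0 <= bfun_norm f.
Proof.
rewrite /bfun_norm.
have [->|/set0P[_ [x _ _]]] := eqVneq (range (fun x => `|f x : R|)) set0.
  by rewrite sup0.
exact: le_trans (bfun_norm_ub f x).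
Qed.

Lemma bfun_normD (f g : bfun) : bfun_norm (f + g) <= bfun_norm f + bfun_norm g.
Proof.
apply: bfun_norm_le => [|x]; first by rewrite addr_ge0 ?bfun_norm_ge0.
by rewrite (le_trans (ler_normD _ _))// lerD// bfun_norm_ub.
Qed.

Lemma bfun_normZ (a : R) (f : bfun) : bfun_norm (a *: f) = `|a| * bfun_norm f.
Proof.
have le b (g : bfun) : bfun_norm (b *: g) <= `|b| * bfun_norm g.
  apply: bfun_norm_le => [|x]; first by rewrite mulr_ge0 ?bfun_norm_ge0.
  by rewrite normrM ler_wpM2l// bfun_norm_ub.
apply/eqP; rewrite eq_le le/=.
have [->|a0] := eqVneq a 0; first by rewrite normr0 mul0r bfun_norm_ge0.
rewrite -ler_pdivlMl ?normr_gt0// -normfV -[in leLHS](scalerK a0 f).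
exact: le.
Qed.

Lemma bfun_norm0_eq0 (f : bfun) : bfun_norm f = 0 -> f = 0.
Proof.
move=> f0; apply/val_inj/funext => x; apply/eqP.
by rewrite -normr_le0 (le_trans (bfun_norm_ub f x))// f0.
Qed.

HB.instance Definition _ :=
  Lmodule_isNormed.Build R bfun bfun_normD bfun_normZ bfun_norm0_eq0.

Lemma bfun_cst_subproof (a : R) : (fun _ : T => a : R^o) \in bfun_pred.
Proof. by apply/bfun_predP; exists `|a|. Qed.

Definition bfun_cst (a : R) : bfun := BFun (bfun_cst_subproof a).

End BoundedFunctions.

Section Amenable.
Context (R : realType) (G : groupType).

Lemma ltranslate_subproof (y : G) (f : bfun R G) :
  (fun x : G => f (y * x)%g) \in @bfun_pred R G.
Proof.
by have /bfun_predP[M fM] := valP f; apply/bfun_predP; exists M => x; exact: fM.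
Qed.

Definition ltranslate (y : G) (f : bfun R G) : bfun R G :=
  BFun (ltranslate_subproof y f).

(* Means are continuous linear functionals on the sup-normed space bfun R G;
   the second condition below is about their operator norm dual_norm. *)
Definition left_invariant_mean (m : dual (bfun R G)) : Prop :=
  [/\ m (bfun_cst G 1) = 1, `|m| = 1 &
      forall (f : bfun R G) (y : G), m (ltranslate y f) = m f].

Definition amenable : Prop := exists m, left_invariant_mean m.

End Amenable.

Record right_gset (G : groupType) (X : Type) := RightGSet {
  gset_op :> X -> G -> X;
  gset_op1 : forall x, gset_op x 1%g = x;
  gset_opM : forall x y z, gset_op x (y * z)%g = gset_op (gset_op x y) z
}.

(* G is a discrete group, so joint continuity of the action is with respect to
   the discrete topology on G. *)
Record banach_left_module (R : realType) (G : groupType)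
    (E : completeNormedModType R) := BanachLeftModule {
  bmod_op :> G -> E -> E;
  bmod_continuous :
    continuous (fun p : discrete_topology G * E => bmod_op p.1 p.2);
  bmod_opM : forall y y' xi, bmod_op y (bmod_op y' xi) = bmod_op (y * y')%g xi;
  bmod_op1 : forall xi, bmod_op 1%g xi = xi;
  bmod_linear : forall y, linear (bmod_op y);
  bmod_bijective : forall y, bijective (bmod_op y);
  bmod_isometric : forall y xi, `|bmod_op y xi| = `|xi|
}.

HB.instance Definition _ (R : realType) (G : groupType)
    (E : completeNormedModType R) (A : banach_left_module G E) (y : G) :=
  GRing.isLinear.Build R E E *:%R (A y) (bmod_linear A y).

Section DualAction.
Context (R : realType) (G : groupType) (E : completeNormedModType R).
Context (A : banach_left_module G E).

Lemma dual_act_subproof (alpha : dual E) (y : G) :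
  (fun xi : E => alpha (A y xi)) \in @dual_pred R E.
Proof.
rewrite inE /=; split=> [a u v|xi].
  by rewrite /= !linearP.
apply: (@cvg_comp _ _ _ (A y) alpha _ (nbhs (A y xi))); last first.
  exact: dual_continuous.
apply/cvgrPdist_lt => e e0; near=> z.
have -> : A y xi - A y z = A y (xi - z).
  by rewrite linearB.
rewrite bmod_isometric; near: z.
exact: (@cvgr_dist_lt _ _ _ (nbhs xi) _ id).
Unshelve. all: by end_near. Qed.

(* <alpha . y, xi> = <alpha, y . xi> *)
Definition dual_act (alpha : dual E) (y : G) : dual E :=
  Dual (dual_act_subproof alpha y).

End DualAction.

(* Main.v *)
(* Averaging f(xy) - f(x).y over x = x0 t^-1 turns the approximate cocycle h
   into an exact cocycle H within delta of h: the cocycle identity comes from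
   the invariance of the mean. Then f(xy) - f(x).y is within 2 delta of H(y),
   that is, (f(xt) - H(t)).t^-1 is within 2 delta of f(x) for every t, and the
   mean of this expression over t is the required F(x). *)
Require Import Defs.
From HB Require Import structures.
From mathcomp Require Import all_boot all_order all_algebra.
From mathcomp Require Import all_classical all_reals all_analysis.

Import Order.TTheory GRing.Theory Num.Theory.
Import numFieldNormedType.Exports.
Local Open Scope ring_scope.

Definition is_mean {R : realType} {T : Type} (m : dual (bfun R T)) : Prop :=
  m (bfun_cst T 1) = 1 /\ `|m| = 1.

Definition norm_bounded {R : realType} {V : normedModType R} {T : Type}
    (phi : T -> V) : Prop :=
  exists M : R, forall t, `|phi t| <= M.

Lemma norm_boundedP {R : realType} {T : Type} (u : T -> R^o) :
  norm_bounded u <-> u \in @bfun_pred R T.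
Proof. exact: bfun_predP. Qed.

(** [f] itself may be unbounded. The functions averaged below stay near a fixed vector, and this is
    how they are seen to have a mean. *)
Lemma norm_bounded_near {R : realType} {V : normedModType R} {T : Type}
    (phi : T -> V) (v : V) (M : R) :
  (forall t, `|phi t - v| <= M) -> norm_bounded phi.
Proof.
move=> phiM; exists (M + `|v|) => t.
by rewrite -[phi t](subrK v) (le_trans (ler_normD _ _))// lerD2r.
Qed.

Section ScalarMean.
Context {R : realType} {T : Type} (m : dual (bfun R T)).

(* Junk value 0 when u is unbounded. *)
Definition fmean (u : T -> R^o) : R^o := m (insubd 0 u).

Lemma fmeanE (u : bfun R T) : fmean u = m u.
Proof. by rewrite /fmean valKd. Qed.

Lemma fmeanP (a : R) (u v : T -> R^o) : norm_bounded u -> norm_bounded v ->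
  fmean (fun t => a *: u t + v t) = a *: fmean u + fmean v.
Proof.
move=> /norm_boundedP bu /norm_boundedP bv.
have -> : (fun t => a *: u t + v t) = (a *: BFun bu + BFun bv : bfun R T).
  by apply/funext.
by rewrite fmeanE (fmeanE (BFun bu)) (fmeanE (BFun bv)); exact: linearP.
Qed.

Lemma fmeanD (u v : T -> R^o) : norm_bounded u -> norm_bounded v ->
  fmean (fun t => u t + v t) = fmean u + fmean v.
Proof.
move=> bu bv; rewrite -[fmean u]scale1r -fmeanP//.
by congr fmean; apply/funext => t; rewrite scale1r.
Qed.

Hypothesis mean_m : is_mean m.

Lemma fmean_cst (a : R) : fmean (fun=> a) = a.
Proof.
have -> : (fun=> a) = (a *: bfun_cst T 1 : bfun R T).
  by apply/funext => t; rewrite /= [RHS]mulr1.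
by rewrite fmeanE linearZ /= mean_m.1 [LHS]mulr1.
Qed.

Lemma fmean_le (u : T -> R^o) (M : R) : 0 <= M ->
  (forall t, `|u t| <= M) -> `|fmean u| <= M.
Proof.
move=> M0 uM.
have /norm_boundedP bu : norm_bounded u by exists M.
rewrite (fmeanE (BFun bu)) (le_trans (dual_norm_eval _ _))//.
by rewrite [dual_norm m]mean_m.2 mul1r; exact: bfun_norm_le.
Qed.

End ScalarMean.

Section DualMean.
Context {R : realType} {T : Type} {E : normedModType R}.
Context (m : dual (bfun R T)) (mean_m : is_mean m).
Implicit Types (phi psi : T -> dual E) (alpha : dual E).

Lemma norm_bounded_eval phi xi :
  norm_bounded phi -> norm_bounded (fun t => phi t xi).
Proof.
move=> [M phiM]; exists (M * `|xi|) => t.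
by rewrite (le_trans (dual_norm_eval _ _))// ler_wpM2r//; exact: phiM.
Qed.

(* Weak-* mean, with junk value 0 when phi is unbounded. *)
Definition dmean phi : dual E :=
  insubd 0 (fun xi => fmean m (fun t => phi t xi)).

(** The evaluations at [xi] are bounded by [M * |xi|] and a mean respects this bound, so the
    pointwise mean is linear and continuous, and [insubd] does not return its default. *)
Lemma dmeanE phi xi :
  norm_bounded phi -> dmean phi xi = fmean m (fun t => phi t xi).
Proof.
move=> bphi; rewrite /dmean insubdK//.
have lin : linear (fun xi => fmean m (fun t => phi t xi)).
  move=> a u v; rewrite -fmeanP; [|exact: norm_bounded_eval..].
  by congr fmean; apply/funext => t; rewrite linearP.
rewrite inE /=; split=> //.
pose L := GRing.isLinear.Build R E R^o *:%R _ lin.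
pose l : {linear E -> R^o} := HB.pack (fun xi => fmean m (fun t => phi t xi)) L.
have [M phiM] := bphi.
apply: (@bounded_linear_continuous _ _ _ l); apply/linear_boundedP.
(* [linear_boundedP] asks for a bound valid for all large [r]; any nonnegative [r] above [M]
   serves. *)
near=> r.
have r0 : 0 <= r by near: r; apply: nbhs_pinfty_ge; exact: num_real.
have Mr : M <= r by near: r; apply: nbhs_pinfty_ge; exact: num_real.
move=> v; rewrite /l /=; apply: fmean_le => // [|t]; first exact: mulr_ge0.
rewrite (le_trans (dual_norm_eval _ _))// ler_wpM2r//.
exact: le_trans (phiM t) Mr.
Unshelve. all: by end_near. Qed.

Lemma dmeanD phi psi : norm_bounded phi -> norm_bounded psi ->
  dmean (fun t => phi t + psi t) = dmean phi + dmean psi.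
Proof.
move=> bphi bpsi; apply/val_inj/funext => xi.
rewrite [RHS]/(dmean phi xi + dmean psi xi) [LHS]dmeanE; last first.
  have [[M phiM] [N psiN]] := (bphi, bpsi).
  by exists (M + N) => t; rewrite (le_trans (ler_normD _ _))// lerD.
rewrite (dmeanE _ xi bphi) (dmeanE _ xi bpsi); apply: fmeanD;
  exact: norm_bounded_eval.
Qed.

(** On the unit ball of [E], subtracting the constant [alpha xi] before averaging leaves a scalar
    function bounded by [M]. Both final estimates come from this. *)
Lemma dmean_near phi alpha (M : R) : 0 <= M ->
  (forall t, `|phi t - alpha| <= M) -> `|dmean phi - alpha| <= M.
Proof.
move=> M0 phiM; apply: dual_norm_le => xi xi1.
have bphi := norm_bounded_near _ _ _ phiM.
have eM t : `|phi t xi - alpha xi| <= M.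
  by apply: le_trans (phiM t); exact: (dual_norm_ub (phi t - alpha)).
rewrite [X in `|X|]/(dmean phi xi - alpha xi) dmeanE//.
have -> : (fun t => phi t xi) = (fun t => (phi t xi - alpha xi) + alpha xi).
  by apply/funext => t; rewrite subrK.
rewrite fmeanD; [|by exists M|by exists `|alpha xi|].
by rewrite fmean_cst// [X in `|X|](addrK (alpha xi) (fmean m _)) fmean_le.
Qed.

Lemma dmean_cst alpha : dmean (fun=> alpha) = alpha.
Proof.
apply/eqP; rewrite -subr_eq0 -normr_le0.
by apply: dmean_near => // t; rewrite subrr normr0.
Qed.

End DualMean.

Lemma fmean_ltranslate {R : realType} {G : groupType} (m : dual (bfun R G))
    (u : G -> R^o) (y : G) : left_invariant_mean m -> norm_bounded u ->
  fmean m (fun t => u (y * t)%g) = fmean m u.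
Proof.
move=> [_ _ invm] /norm_boundedP bu.
by rewrite (fmeanE m (BFun bu)) -(invm _ y) -fmeanE.
Qed.

Lemma dmean_ltranslate {R : realType} {G : groupType} {E : normedModType R}
    (m : dual (bfun R G)) (phi : G -> dual E) (y : G) :
  left_invariant_mean m -> norm_bounded phi ->
  dmean m (fun t => phi (y * t)%g) = dmean m phi.
Proof.
move=> invm bphi.
have byphi : norm_bounded (fun t => phi (y * t)%g).
  by have [M phiM] := bphi; exists M => t.
have mean_m : is_mean m by case: invm.
apply/val_inj/funext => xi; rewrite [LHS]dmeanE// [RHS]dmeanE//.
apply: (@fmean_ltranslate _ _ _ (fun t => phi t xi)) => //.
exact: norm_bounded_eval.
Qed.

Section DualActTheory.
Context {R : realType} {G : groupType} {E : completeNormedModType R}.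
Context (A : banach_left_module G E).
Implicit Types (alpha beta : dual E) (y z : G).

Lemma dual_actB alpha beta y :
  dual_act A (alpha - beta) y = dual_act A alpha y - dual_act A beta y.
Proof. exact/val_inj. Qed.

Lemma dual_act1 alpha : dual_act A alpha 1%g = alpha.
Proof. by apply/val_inj/funext => xi /=; rewrite bmod_op1. Qed.

Lemma dual_actM alpha y z :
  dual_act A alpha (y * z)%g = dual_act A (dual_act A alpha y) z.
Proof. by apply/val_inj/funext => xi /=; rewrite bmod_opM. Qed.

(** The isometry [A y] maps the unit ball into itself. *)
Lemma dual_act_norm_le alpha y : `|dual_act A alpha y| <= `|alpha|.
Proof.
apply: dual_norm_le => xi xi1; apply: (@dual_norm_ub _ _ alpha (A y xi)).
by rewrite bmod_isometric.
Qed.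

Lemma norm_bounded_act {T : Type} (phi : T -> dual E) y :
  norm_bounded phi -> norm_bounded (fun t => dual_act A (phi t) y).
Proof.
move=> [M phiM]; exists M => t.
exact: le_trans (dual_act_norm_le _ _) (phiM t).
Qed.

(** The mean is weak-*: evaluated at [xi], both sides are the scalar mean of [phi t (A y xi)]. *)
Lemma dmean_act {T : Type} (m : dual (bfun R T)) (phi : T -> dual E) y :
  is_mean m -> norm_bounded phi ->
  dmean m (fun t => dual_act A (phi t) y) = dual_act A (dmean m phi) y.
Proof.
move=> mean_m bphi; apply/val_inj/funext => xi.
rewrite [LHS]dmeanE//; last exact: norm_bounded_act.
exact/esym/(dmeanE m mean_m phi (A y xi) bphi).
Qed.

End DualActTheory.

Theorem theorem3p1 (R : realType) (G : groupType) (amG : amenable R G)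
    (X : Type) (X0 : inhabited X) (ract : right_gset G X)
    (E : completeNormedModType R) (A : banach_left_module G E)
    (delta : R) (delta0 : 0 <= delta) (f : X -> dual E) (h : G -> dual E)
    (fh : forall (x : X) (y : G),
      `|f (ract x y) - dual_act A (f x) y - h y| <= delta) :
  exists (F : X -> dual E) (H : G -> dual E),
    forall (x : X) (y z : G),
      [/\ H (y * z)%g = dual_act A (H y) z + H z,
          F (ract x y) = dual_act A (F x) y + H y,
          `|H y - h y| <= delta &
          `|F x - f x| <= 2 * delta].
Proof.
have [m invm] := amG; have [x0] := X0.
have mean_m : is_mean m by case: invm.
(* With [t^-1], left translation of [t] by [y^-1] moves the base point x0 t^-1 to x0 t^-1 y. *)
pose p y t := f (ract x0 (t^-1 * y)%g) - dual_act A (f (ract x0 t^-1%g)) y.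
have ph y t : `|p y t - h y| <= delta by rewrite /p gset_opM.
have bp y : norm_bounded (p y) := norm_bounded_near _ _ _ (ph y).
pose H y := dmean m (p y).
have Hh y : `|H y - h y| <= delta by exact: dmean_near.
have HM y z : H (y * z)%g = dual_act A (H y) z + H z.
  (* After translation the identity holds for each [t]: p (yz) t = (p y t).z + p z (y^-1 t), the
     terms f(x0 t^-1 y).z cancelling. *)
  rewrite /H -dmean_act// -(dmean_ltranslate m (p z) y^-1%g invm (bp z)).
  rewrite -dmeanD//.
  - congr dmean; apply/funext => t; rewrite /p dual_actB -dual_actM.
    by rewrite invgM invgK mulgA [RHS]addrC [RHS]addrA subrK.
  - exact: norm_bounded_act.
  - by have [M pM] := bp z; exists M => t.
pose q x t := dual_act A (f (ract x t) - H t) t^-1%g.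
have qf x t : `|q x t - f x| <= 2 * delta.
  (* Writing [f x] as (f(x).t).t^-1 puts the whole difference under the action of [t^-1], which does
     not increase norms. *)
  have -> : q x t - f x =
      dual_act A (f (ract x t) - H t - dual_act A (f x) t) t^-1%g.
    by rewrite [in RHS]dual_actB -dual_actM mulgV dual_act1.
  apply: le_trans (dual_act_norm_le _ _ _) _.
  (* One [delta] comes from the hypothesis on [f] and [h], the other from the distance of [H] to
     [h]. *)
  have -> : f (ract x t) - H t - dual_act A (f x) t =
      (f (ract x t) - dual_act A (f x) t - h t) - (H t - h t).
    by rewrite opprB [in RHS]addrA subrK addrAC.
  by rewrite mulrDl mul1r (le_trans (ler_normB _ _))// lerD.
have bq x : norm_bounded (q x) := norm_bounded_near _ _ _ (qf x).
exists (fun x => dmean m (q x)), H => x y z; split=> //; last first.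
  by apply: dmean_near => //; rewrite mulr_ge0.
rewrite -dmean_act//.
(* With [H y] read as the mean of a constant, it remains to check q (xy) t = (q x (yt)).y + H y for
   each [t]; this follows from H(yt) = H(y).t + H(t), since acting by [t^-1] turns H(y).t back into
   [H y]. *)
rewrite -(dmean_ltranslate m (fun t => dual_act A (q x t) y) y invm); last first.
  exact: norm_bounded_act.
rewrite -[H y](dmean_cst m mean_m) -dmeanD//.
- congr dmean; apply/funext => t.
  rewrite /q -dual_actM invgM mulgVK gset_opM HM opprD addrA.
  by rewrite addrAC [in RHS]dual_actB -dual_actM mulgV dual_act1 subrK.
- have [M qM] := norm_bounded_act A (q x) y (bq x).
  by exists M => t; exact: qM.
- by exists `|H y|.
Qed.
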